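(* Let $\overline{p}(n)$ denote the number of overpartitions of $n$. For all $\alpha\ge1$, $n\ge0$ and $i\in\{1,2\}$: (1) $\overline{p}(4\cdot3^{2\alpha}n+(4i+3)\cdot3^{2\alpha-1})\equiv0\pmod{2^2}$; (2) $\overline{p}(4\cdot3^{2\alpha}n+(4i+6)\cdot3^{2\alpha-1})\equiv0\pmod{2^3}$; (3) $\overline{p}(4\cdot3^{4\alpha}n+(4i+9)\cdot3^{4\alpha-1})\equiv0\pmod{2^4}$.
   Context: An overpartition of $n$ is a partition of $n$ in which the first occurrence of each distinct part may be overlined. Its generating function is $\sum_{n\ge0}\overline{p}(n)q^n=\prod_{n\ge1}\frac{1+q^n}{1-q^n}=\prod_{n\ge1}\frac{1-q^{2n}}{(1-q^n)^2}$. *)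

(* Defs.v *)
From mathcomp Require Import all_boot.

Set Implicit Arguments.
Unset Strict Implicit.
Unset Printing Implicit Defensive.

Definition is_partition (n : nat) (s : seq nat) : bool :=
  [&& sorted geq s, 0 \notin s & sumn s == n].

(* The entry (a, b) is the part a, overlined iff b = true.  The pairwise
   condition says that an overlined part differs from every earlier part,
   i.e. that only the first occurrence of a part can be overlined. *)
Definition is_overpartition (n : nat) (s : seq (nat * bool)) : bool :=
  is_partition n [seq x.1 | x <- s] &&
  pairwise (fun x y : nat * bool => y.2 ==> (y.1 != x.1)) s.

(* Number of overpartitions of n, summed over the number k of parts.  The bounds
   on k and on the parts lose nothing, by overpartition_bounded below. *)
Definition overp (n : nat) : nat :=
  \sum_(k < n.+1)
    #|[set t : k.-tuple ('I_n.+1 * bool) |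
        is_overpartition n [seq (val x.1, x.2) | x <- t]]|.

Lemma overpartition_bounded (n : nat) (s : seq (nat * bool)) :
  is_overpartition n s -> (size s < n.+1) && all (fun x => x.1 < n.+1) s.
Proof.
case/andP=> /and3P[_ pos /eqP <-] _.
elim: s pos => //= [[a b] s] IHs; rewrite inE negb_or eq_sym -lt0n /=.
case/andP=> a_gt0 /IHs/andP[les alls]; rewrite !ltnS leq_addr /=.
rewrite -add1n leq_add //=; apply: sub_all alls => x; rewrite !ltnS => le_x.
exact: leq_trans le_x (leq_addl _ _).
Qed.

(* Main.v *)
(** Let [theta] be the sum of [(-1)^j q^(j^2)] over [j >= 1]. Gauss's identity
    says that [1 + 2 * theta] is the inverse of the overpartition generating
    function, so modulo 16 the latter is
    [1 - 2 * theta + 4 * theta^2 - 8 * theta^3].  If the exponent of 3 in [N] is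
    odd, then [N] is not a sum of two squares, so [theta] and [theta^2] do not
    contribute at [N], which gives divisibility by 8.  For divisibility by 16,
    [theta^3] is congruent to [theta(q) * theta(q^2)] modulo 2, so its
    coefficient has the parity of the number of positive solutions of
    [x^2 + 2 y^2 = N].  Multiplication by the prime [1 + sqrt (-2)] of norm 3
    shows that this number is even when the exponent of 3 in [N] is 3 modulo 4.

    Gauss's identity is the limit of the finite identity
    [sum_k (-1)^k q^((k-n)^2) [2n; k]_q = (-1)^n prod_(i<n) (1 - q^(2i+1))]. *)

Require Import Defs.
From mathcomp Require Import all_boot all_algebra zify ring.

Set Implicit Arguments.
Unset Strict Implicit.
Unset Printing Implicit Defensive.

Import GRing.Theory.

(** * Gauss's identity *)

Section Gauss_identity.
Local Open Scope ring_scope.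

(** * q-binomial coefficients *)

Section QBinomial.
Variables (R : comNzRingType) (q : R).

Fixpoint qbinom (n k : nat) : R :=
  match n, k with
  | _, 0 => 1
  | 0, _.+1 => 0
  | n'.+1, k'.+1 => qbinom n' k' + q ^+ k'.+1 * qbinom n' k'.+1
  end.

Definition qfact (n : nat) : R := \prod_(i < n) (1 - q ^+ i.+1).

Lemma qbinom0 n : qbinom n 0 = 1.
Proof. by case: n. Qed.

Lemma qbinomS n k :
  qbinom n.+1 k.+1 = qbinom n k + q ^+ k.+1 * qbinom n k.+1.
Proof. by []. Qed.

Lemma qbinom_small n k : (n < k)%N -> qbinom n k = 0.
Proof.
elim: n k => [|n IHn] [|k] //= ltnk.
by rewrite !IHn ?mulr0 ?addr0 // ltnW.
Qed.

Lemma qbinomn n : qbinom n n = 1.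
Proof. by elim: n => //= n ->; rewrite qbinom_small ?mulr0 ?addr0. Qed.

(** The dual Pascal rule: expand by the first rule, apply the induction hypothesis to both terms,
    and fold back with the first rule. *)
Lemma qbinomS' n k :
  qbinom n.+1 k.+1 = q ^+ (n - k) * qbinom n k + qbinom n k.+1.
Proof.
elim: n k => [|n IHn] k.
  by case: k => [|k] /=; rewrite ?expr0; ring.
case: (ltnP n k) => [ltnk|lekn].
  rewrite [qbinom n.+2 _]qbinomS (qbinom_small (k := k.+1)) //.
  rewrite mulr0; congr (_ + _).
  by rewrite (_ : n.+1 - k = 0)%N ?mul1r //; apply/eqP; rewrite subn_eq0.
case: k lekn => [|k] lekn.
  rewrite qbinomS {1}(IHn 0) qbinomS !qbinom0 !subn0 !mulr1.
  rewrite mulrDr -exprD add1n; ring.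
rewrite qbinomS {1}(IHn k) {1}(IHn k.+1) [qbinom n.+1 k.+1]qbinomS.
rewrite [qbinom n.+1 k.+2]qbinomS subSS.
rewrite !mulrDr !mulrA -!exprD.
have -> : (k.+2 + (n - k.+1) = n.+1)%N by lia.
have -> : (n - k + k.+1 = n.+1)%N by lia.
ring.
Qed.

Lemma qbinom_sub n k : (k <= n)%N -> qbinom n (n - k) = qbinom n k.
Proof.
elim: n k => [|n IHn] [|k] // lekn; rewrite ?subn0 ?qbinomn ?qbinom0 //.
rewrite subSS; case: (ltnP k n) => [ltkn|lenk].
  rewrite -(subnSK ltkn) qbinomS' qbinomS subnSK // !IHn ?subKn //.
  by rewrite addrC.
rewrite (_ : k = n) ?subnn ?qbinom0 ?qbinomn //; lia.
Qed.

Lemma qfactS n : qfact n.+1 = qfact n * (1 - q ^+ n.+1).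
Proof. by rewrite /qfact big_ord_recr. Qed.

(** Division-free factorial formula. The induction rests on 1 - q^(m+n+2) = (1 - q^(m+1)) + q^(m+1)
    (1 - q^(n+1)). *)
Lemma qbinom_fact m n : qbinom (m + n) m * qfact m * qfact n = qfact (m + n).
Proof.
elim: m n => [|m IHm] n.
  by rewrite qbinom0 /qfact big_ord0 !mul1r.
elim: n => [|n IHn].
  by rewrite addn0 qbinomn /qfact big_ord0; ring.
have E1 := IHm n.+1; rewrite addnS in E1; rewrite addSn in IHn.
rewrite addSn addnS qbinomS [qfact (m + n).+2]qfactS.
have -> : q ^+ (m + n).+2 = q ^+ m.+1 * q ^+ n.+1.
  by rewrite -exprD addSn addnS.
transitivity (qfact (m + n).+1 * (1 - q ^+ m.+1) +
   qfact (m + n).+1 * (q ^+ m.+1 * (1 - q ^+ n.+1))); last by ring.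
by rewrite -{1}E1 -IHn !qfactS; ring.
Qed.

End QBinomial.

Arguments qbinom : simpl never.

(** * The finite form of Gauss's identity *)

Section Gauss.
Variables (R : comNzRingType) (q : R).

Local Notation qb := (qbinom q).

Lemma sum_qbinomS n (c : nat -> R) :
  \sum_(0 <= k < n.+2) c k * qb n.+1 k =
  \sum_(0 <= k < n.+1) (c k.+1 + q ^+ k * c k) * qb n k.
Proof.
under [RHS]eq_bigr do rewrite mulrDl.
rewrite big_split /= addrC.
have -> : \sum_(0 <= k < n.+1) q ^+ k * c k * qb n k =
          \sum_(0 <= k < n.+2) q ^+ k * c k * qb n k.
  by rewrite [RHS]big_nat_recr //= qbinom_small // mulr0 addr0.
rewrite ![\sum_(0 <= k < n.+2) _]big_nat_recl // !qbinom0 expr0 mul1r -addrA.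
congr (_ + _); rewrite -big_split /=.
by apply: eq_bigr => k _; rewrite qbinomS; ring.
Qed.

Lemma sum_qbinomS' n (c : nat -> R) :
  \sum_(0 <= k < n.+2) c k * qb n.+1 k =
  \sum_(0 <= k < n.+1) (q ^+ (n - k) * c k.+1 + c k) * qb n k.
Proof.
under [RHS]eq_bigr do rewrite mulrDl.
rewrite big_split /= addrC.
have -> : \sum_(0 <= k < n.+1) c k * qb n k = \sum_(0 <= k < n.+2) c k * qb n k.
  by rewrite [RHS]big_nat_recr //= qbinom_small // mulr0 addr0.
rewrite ![\sum_(0 <= k < n.+2) _]big_nat_recl // !qbinom0 -addrA.
congr (_ + _); rewrite -big_split /=.
by apply: eq_bigr => k _; rewrite qbinomS'; ring.
Qed.

(* One of the two truncated differences is 0: the exponent is [(k - n)^2]. *)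
Definition gauss_sum (n : nat) : R :=
  \sum_(0 <= k < (2 * n).+1)
    (-1) ^+ k * q ^+ ((k - n) ^ 2 + (n - k) ^ 2) * qb (2 * n) k.

(* In integers, the exponent is [(k - n) * (k - n - 1)]. *)
Definition gauss_odd_sum (n : nat) : R :=
  \sum_(0 <= k < (2 * n).+2)
    (-1) ^+ k * q ^+ ((k - n) * (k - n.+1) + (n - k) * (n.+1 - k))
    * qb (2 * n).+1 k.

(** The reflection k -> 2n+1-k fixes the exponent and the q-binomial but flips the sign, so the two
    halves of the sum cancel. *)
Lemma gauss_odd_sum0 n : gauss_odd_sum n = 0.
Proof.
rewrite /gauss_odd_sum (@big_cat_nat _ _ _ n.+1) //=; last by lia.
rewrite [X in _ + X](_ : _ = - \sum_(0 <= k < n.+1)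
    (-1) ^+ k * q ^+ ((k - n) * (k - n.+1) + (n - k) * (n.+1 - k))
    * qb (2 * n).+1 k) ?subrr //.
rewrite -sumrN big_nat_rev /= -{1}[n.+1]add0n big_addn.
rewrite (_ : (2 * n).+2 - n.+1 = n.+1)%N; last by lia.
apply: eq_big_nat => k /andP[_ lekn].
rewrite (_ : (n.+1 + (2 * n).+2 - (k + n.+1).+1 = (2 * n).+1 - k)%N); last by lia.
rewrite qbinom_sub; last by lia.
rewrite -!mulNr; congr (_ * _ * _).
  rewrite -signr_odd oddB; last by lia.
  rewrite /= mul2n odd_double /= -[in RHS]signr_odd.
  by case: (odd k); rewrite ?expr0 ?expr1 ?opprK.
by congr (_ ^+ _); nia.
Qed.

(** Two Pascal expansions lead from row 2n+2 to row 2n. The second rule splits off a multiple of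
    [gauss_odd_sum n], which vanishes; the first rule turns the rest into
    [- gauss_sum n + q ^+ n.+1 * D], where [D] is [q ^+ n * gauss_sum n]. *)
Lemma gauss_sumS n :
  gauss_sum n.+1 = - (1 - q ^+ (2 * n).+1) * gauss_sum n.
Proof.
pose D := \sum_(0 <= k < (2 * n).+1)
  (-1) ^+ k * q ^+ ((k - n) * (k - n.+1) + (n - k) * (n.+1 - k)) * qb (2 * n) k.
have DE : D = q ^+ n * gauss_sum n.
  (* second Pascal rule in the vanishing sum [gauss_odd_sum n] *)
  apply/eqP; rewrite -subr_eq0 -(gauss_odd_sum0 n) /gauss_odd_sum.
  rewrite sum_qbinomS' /D mulr_sumr -sumrB.
  apply/eqP/eq_big_nat => k /andP[_ ltk]; rewrite exprS.
  rewrite mulrDl addrC; congr (_ + _).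
  rewrite -mulNr !mulrA; congr (_ * _).
  have e : (n + ((k - n) ^ 2 + (n - k) ^ 2) = 2 * n - k +
    ((k.+1 - n) * (k.+1 - n.+1) + (n - k.+1) * (n.+1 - k.+1)))%N by nia.
  transitivity ((-1) ^+ k * - q ^+ (n + ((k - n) ^ 2 + (n - k) ^ 2))).
    by rewrite (exprD q n); ring.
  by rewrite e exprD; ring.
have odd_term k : (k < (2 * n).+2)%N ->
  q ^+ ((2 * n).+1 - k) *
    ((-1) ^+ k.+1 * q ^+ ((k.+1 - n.+1) ^ 2 + (n.+1 - k.+1) ^ 2)) =
  - q ^+ n.+1 * ((-1) ^+ k *
     q ^+ ((k - n) * (k - n.+1) + (n - k) * (n.+1 - k))).
  move=> ltk; rewrite exprS.
  have e : ((2 * n).+1 - k + ((k.+1 - n.+1) ^ 2 + (n.+1 - k.+1) ^ 2) =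
    n.+1 + ((k - n) * (k - n.+1) + (n - k) * (n.+1 - k)))%N by nia.
  transitivity ((-1) ^+ k * - q ^+ ((2 * n).+1 - k +
    ((k.+1 - n.+1) ^ 2 + (n.+1 - k.+1) ^ 2))).
    by rewrite (exprD q ((2 * n).+1 - k)); ring.
  by rewrite e exprD; ring.
have even_term k : q ^+ k *
    ((-1) ^+ k * q ^+ ((k - n.+1) ^ 2 + (n.+1 - k) ^ 2)) =
  q ^+ n.+1 * ((-1) ^+ k *
     q ^+ ((k - n) * (k - n.+1) + (n - k) * (n.+1 - k))).
  have e : (k + ((k - n.+1) ^ 2 + (n.+1 - k) ^ 2) =
    n.+1 + ((k - n) * (k - n.+1) + (n - k) * (n.+1 - k)))%N by nia.
  by rewrite !(mulrCA _ ((-1) ^+ k)) -!exprD e.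
rewrite {1}/gauss_sum (_ : (2 * n.+1 = (2 * n).+2)%N); last by lia.
rewrite sum_qbinomS'.
transitivity (- q ^+ n.+1 * gauss_odd_sum n + (- gauss_sum n + q ^+ n.+1 * D)).
  rewrite /gauss_odd_sum mulr_sumr.
  under eq_big_nat => k /andP[_ ltk] do rewrite mulrDl odd_term // -mulrA.
  rewrite big_split /= sum_qbinomS /D mulr_sumr -sumrN -big_split /=.
  congr (_ + _); apply: eq_bigr => k _.
  rewrite even_term mulrDl subSS (_ : (n.+1 - k.+1)%N = (n - k)%N) //.
  by rewrite exprS; ring.
rewrite gauss_odd_sum0 DE exprS (_ : (2 * n).+1 = (n + n.+1)%N); last by lia.
by rewrite exprD exprS; ring.
Qed.

Lemma gauss_sumE n :
  gauss_sum n = (-1) ^+ n * \prod_(i < n) (1 - q ^+ (2 * i).+1).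
Proof.
elim: n => [|n IHn]; last by rewrite gauss_sumS IHn big_ord_recr /= [(-1) ^+ n.+1]exprS; ring.
by rewrite /gauss_sum muln0 big_nat1 big_ord0 qbinom0 !mulr1.
Qed.

(** The factors (1 - q^(i+1)) (1 + q^(i+1)) supply the even exponents of [qfact q (2 * n)], and the
    first product supplies the odd ones. *)
Lemma gauss_prod n :
  (\prod_(i < n) (1 - q ^+ (2 * i).+1)) * qfact q n * \prod_(i < n) (1 + q ^+ i.+1)
  = qfact q (2 * n).
Proof.
elim: n => [|n IHn]; first by rewrite muln0 /qfact !big_ord0 !mul1r.
rewrite (_ : (2 * n.+1 = (2 * n).+2)%N); last by lia.
rewrite !qfactS -IHn !big_ord_recr /=.
rewrite (_ : q ^+ (2 * n).+2 = q ^+ n.+1 ^+ 2); first by ring.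
by rewrite -exprM; congr (_ ^+ _); lia.
Qed.

End Gauss.

(** * Congruence modulo a ring element *)

Section Congruence.
Variable R : comNzRingType.
Implicit Types a b c d z : R.

(** With [z] a power of [q] this replaces equality of truncated power series; with [z = 2] it
    expresses parity. *)
Definition eqmod z a b := exists c, a = b + c * z.

Lemma eqmod_refl z a : eqmod z a a.
Proof. by exists 0; rewrite mul0r addr0. Qed.

Lemma eqmod_sym z a b : eqmod z a b -> eqmod z b a.
Proof. by case=> c ->; exists (- c); ring. Qed.

Lemma eqmod_trans z b a c : eqmod z a b -> eqmod z b c -> eqmod z a c.
Proof. by case=> x -> [y ->]; exists (x + y); ring. Qed.

Lemma eqmodD z a b c d : eqmod z a b -> eqmod z c d -> eqmod z (a + c) (b + d).
Proof. by case=> x -> [y ->]; exists (x + y); ring. Qed.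

Lemma eqmodM z a b c d : eqmod z a b -> eqmod z c d -> eqmod z (a * c) (b * d).
Proof. by case=> x -> [y ->]; exists (b * y + x * d + x * y * z); ring. Qed.

Lemma eqmod_sum z m n (f g : nat -> R) :
  (forall i, (m <= i < n)%N -> eqmod z (f i) (g i)) ->
  eqmod z (\sum_(m <= i < n) f i) (\sum_(m <= i < n) g i).
Proof.
move=> fg; rewrite big_nat [X in eqmod _ _ X]big_nat.
elim/big_ind2: _ => //; first exact: eqmod_refl.
by move=> *; apply: eqmodD.
Qed.

Lemma eqmod_inv z a n : exists b, eqmod (z ^+ n) ((1 - a * z) * b) 1.
Proof.
exists (\sum_(i < n) (a * z) ^+ i); exists (- a ^+ n).
rewrite -[1 - _]opprB mulNr -subrX1 exprMn; ring.
Qed.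

(** An element congruent to 1 modulo [z] is invertible modulo every power of [z], by a finite
    geometric sum. This is how [qfact] gets divided out. *)
Lemma eqmod_cancel z n u a b :
  eqmod z u 1 -> eqmod (z ^+ n) (u * a) (u * b) -> eqmod (z ^+ n) a b.
Proof.
case=> c ->; have [v uv] := eqmod_inv z (- c) n => ab.
have {uv} uv x : eqmod (z ^+ n) x (v * ((1 + c * z) * x)).
  apply: eqmod_sym; rewrite mulrA (_ : _ * x = (1 - - c * z) * v * x); last by ring.
  by rewrite -[X in eqmod _ _ X]mul1r; apply: eqmodM => //; apply: eqmod_refl.
apply: eqmod_trans (uv a) _; apply: eqmod_trans (eqmod_sym (uv b)).
by apply: eqmodM => //; apply: eqmod_refl.
Qed.

End Congruence.

(** * Passage to the limit modulo q^(n+1) *)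

Section GaussLimit.
Variables (R : comNzRingType) (q : R).

Lemma qfact_eqmod m n :
  (m <= n)%N -> eqmod (q ^+ m.+1) (qfact q n) (qfact q m).
Proof.
move/subnK <-; elim: (n - m)%N => [|k IHk]; first exact: eqmod_refl.
rewrite addSn qfactS -[X in eqmod _ _ X]mulr1; apply: eqmodM => //.
by exists (- q ^+ k); rewrite -addnS exprD; ring.
Qed.

Lemma qfact_eqmod1 n : eqmod q (qfact q n) 1.
Proof.
by have := qfact_eqmod (leq0n n); rewrite /qfact big_ord0 expr1.
Qed.

(** In [qbinom_fact], the factorials of 2n and 2n-k agree with [qfact q n] modulo q^(n+1). For k <=
    n the factorial of k agrees with it only modulo q^(k+1), and the square power of q makes up for
    the loss. *)
Lemma qbinom_eqmod n k : (k <= 2 * n)%N ->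
  eqmod (q ^+ n.+1)
    (q ^+ ((k - n) ^ 2 + (n - k) ^ 2) * qbinom q (2 * n) k * qfact q n)
    (q ^+ ((k - n) ^ 2 + (n - k) ^ 2)).
Proof.
wlog lekn : k / (k <= n)%N => [hw lek|_].
  case: (leqP k n) => [/hw|ltnk]; first exact.
  have := hw (2 * n - k)%N; rewrite qbinom_sub //.
  have -> : (2 * n - k - n = n - k)%N by lia.
  have -> : (n - (2 * n - k) = k - n)%N by lia.
  by rewrite addnC; apply; lia.
have := qbinom_fact q k (2 * n - k); rewrite subnKC; last by lia.
set e := (_ + _)%N; set x := qbinom _ _ _ => xE.
apply: (@eqmod_cancel _ _ _ (qfact q n)); first exact: qfact_eqmod1.
apply: (@eqmod_trans _ _ (q ^+ e * (x * qfact q k * qfact q (2 * n - k)))).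
  have [c En] := qfact_eqmod lekn.
  have [|d ->] := @qfact_eqmod n (2 * n - k); first by lia.
  (* This holds because (n - k)^2 >= n - k, so e + k + 1 >= n + 1. *)
  have [f ef] : exists f, (e + k.+1 = f + n.+1)%N.
    by exists (e + k.+1 - n.+1)%N; rewrite /e; nia.
  have ee : q ^+ e * q ^+ k.+1 = q ^+ f * q ^+ n.+1 by rewrite -!exprD ef.
  exists (q ^+ f * x * qfact q n * c - q ^+ e * x * qfact q k * d).
  transitivity (q ^+ e * x * qfact q n * (qfact q k + c * q ^+ k.+1)).
    by rewrite -En; ring.
  transitivity (q ^+ e * x * qfact q n * qfact q k +
      x * qfact q n * c * (q ^+ f * q ^+ n.+1)); last by ring.
  by rewrite -ee; ring.
rewrite xE mulrC; apply: eqmodM; last exact: eqmod_refl.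
by apply: qfact_eqmod; lia.
Qed.

(** Reindex by j = |k - n|: the middle term gives 1, and each j >= 1 arises once on either side. *)
Lemma sum_signed_squares n :
  \sum_(0 <= k < (2 * n).+1) (-1) ^+ k * q ^+ ((k - n) ^ 2 + (n - k) ^ 2) =
  (-1) ^+ n * (1 + 2 * \sum_(1 <= j < n.+1) (-1) ^+ j * q ^+ (j ^ 2)).
Proof.
have right : \sum_(n.+1 <= k < (2 * n).+1)
    (-1) ^+ k * q ^+ ((k - n) ^ 2 + (n - k) ^ 2) =
  (-1) ^+ n * \sum_(1 <= j < n.+1) (-1) ^+ j * q ^+ (j ^ 2).
  rewrite -{1}[n.+1]add1n big_addn (_ : (2 * n).+1 - n = n.+1)%N; last by lia.
  rewrite mulr_sumr; apply: eq_bigr => j _.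
  rewrite addnK (_ : (n - (j + n) = 0)%N); last by lia.
  by rewrite addn0 addnC exprD mulrA.
rewrite (@big_cat_nat _ _ _ n) //=; last by lia.
rewrite [X in _ + X]big_ltn; last by lia.
rewrite right subnn expr0 mulr1.
suff -> : \sum_(0 <= k < n) (-1) ^+ k * q ^+ ((k - n) ^ 2 + (n - k) ^ 2) =
  (-1) ^+ n * \sum_(1 <= j < n.+1) (-1) ^+ j * q ^+ (j ^ 2) by ring.
rewrite big_add1 /= big_nat_rev mulr_sumr; apply: eq_big_nat => j /andP[_ ltjn].
rewrite add0n mulrA -exprD.
have -> : (n - j.+1 - n = 0)%N by lia.
have -> : (n - (n - j.+1) = j.+1)%N by lia.
by rewrite add0n -signr_odd -[in RHS]signr_odd oddB // oddD.
Qed.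

(** Multiplying the finite identity by [qfact q n] removes the q-binomials up to the modulus, and
    [gauss_prod] evaluates the product side. *)
Lemma gauss_eqmod n :
  eqmod (q ^+ n.+1)
    ((1 + 2 * \sum_(1 <= j < n.+1) (-1) ^+ j * q ^+ (j ^ 2))
      * \prod_(i < n) (1 + q ^+ i.+1))
    (qfact q n).
Proof.
set S := 1 + _; set P := \prod_(i < n) _.
have sign2 : (-1) ^+ n * (-1) ^+ n = 1 :> R.
  by rewrite -expr2 sqrr_sign.
have gaussS : eqmod (q ^+ n.+1) (gauss_sum q n * qfact q n) ((-1) ^+ n * S).
  rewrite -sum_signed_squares mulr_suml; apply: eqmod_sum => k /andP[_ ltk].
  by rewrite -!mulrA; apply: eqmodM; [exact: eqmod_refl|rewrite mulrA; exact: qbinom_eqmod].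
have -> : S * P = (-1) ^+ n * (((-1) ^+ n * S) * P).
  by rewrite !mulrA sign2 mul1r.
apply: (@eqmod_trans _ _ ((-1) ^+ n * (gauss_sum q n * qfact q n * P))).
  apply: eqmodM; first exact: eqmod_refl.
  by apply: eqmodM; [exact: eqmod_sym|exact: eqmod_refl].
rewrite gauss_sumE -!mulrA [X in eqmod _ X]mulrA sign2 mul1r mulrA gauss_prod.
by apply: qfact_eqmod; lia.
Qed.

End GaussLimit.

End Gauss_identity.

(** * Enumeration of overpartitions *)

(* The lists that may follow a part [m]: here [m] is no longer overlined.  [A]
   enumerates the overpartitions with smaller parts and [k] is fuel. *)
Fixpoint overparts_tail (m : nat) (A : nat -> seq (seq (nat * bool))) (k n : nat) :=
  A n ++ if k is k'.+1 then
           if m <= n then [seq (m, false) :: s | s <- overparts_tail m A k' (n - m)]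
           else [::]
         else [::].

Fixpoint overparts (m n : nat) : seq (seq (nat * bool)) :=
  if m is m'.+1 then
    overparts m' n ++
      if m <= n then
        [seq (m, true) :: s | s <- overparts_tail m (overparts m') n (n - m)] ++
        [seq (m, false) :: s | s <- overparts_tail m (overparts m') n (n - m)]
      else [::]
  else if n == 0 then [:: [::]] else [::].

Lemma overparts_tailS m A k n :
  overparts_tail m A k.+1 n = A n ++
    if m <= n then [seq (m, false) :: s | s <- overparts_tail m A k (n - m)]
    else [::].
Proof. by []. Qed.

Definition overpart_le (m n : nat) (s : seq (nat * bool)) :=
  is_overpartition n s && all (fun x => x.1 <= m) s.

Lemma is_overpartition_nil n : is_overpartition n [::] = (n == 0).
Proof. by rewrite /is_overpartition /is_partition /= andbT eq_sym. Qed.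

(** Whether or not the head [a] is overlined, a later overlined copy of [a] would not be a first
    occurrence. *)
Lemma is_overpartition_cons n a b s :
  is_overpartition n ((a, b) :: s) =
  [&& 0 < a, a <= n, overpart_le a (n - a) s & (a, true) \notin s].
Proof.
rewrite /overpart_le /is_overpartition /is_partition /=.
rewrite path_sortedE; last by move=> x y z /= xy yz; apply: leq_trans yz xy.
rewrite all_map inE negb_or (eq_sym 0 a) -lt0n.
have -> : all (fun y : nat * bool => y.2 ==> (y.1 != a)) s = ((a, true) \notin s).
  elim: s => //= -[c d] s ->; rewrite inE negb_or xpair_eqE /= eq_sym [_ == d]eq_sym.
  by case: d; rewrite /= ?andbT // andbF.
rewrite (@eq_all _ (preim fst (geq a)) (fun x => x.1 <= a)) //.
have -> : (a + sumn [seq x.1 | x <- s] == n) =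
          (a <= n) && (sumn [seq x.1 | x <- s] == n - a).
  by apply/eqP/andP => [<-|[le /eqP->]]; rewrite ?leq_addr ?addKn ?eqxx ?subnKC.
by rewrite -!andbA; do !bool_congr.
Qed.

Lemma all_le_trans m m' (s : seq (nat * bool)) :
  m <= m' -> all (fun x => x.1 <= m) s -> all (fun x => x.1 <= m') s.
Proof. by move=> mm; apply: sub_all => x /leq_trans; apply. Qed.

Lemma overpart_le_cons m n a b s :
  overpart_le m n ((a, b) :: s) = (a <= m) && is_overpartition n ((a, b) :: s).
Proof.
rewrite /overpart_le /= andbCA; case: leqP => //= leam.
rewrite andb_idr // is_overpartition_cons => /and4P[_ _ /andP[_ als] _].
exact: all_le_trans als.
Qed.

(** Each added part lowers [n] by at least 1, so fuel [k >= n] suffices. *)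
Lemma overparts_tailP m A k n :
  (forall n s, (s \in A n) = overpart_le m n s) -> n <= k ->
  forall s, (s \in overparts_tail m.+1 A k n) =
            overpart_le m.+1 n s && ((m.+1, true) \notin s).
Proof.
move=> AP; elim: k n => [|k IHk] n lenk s.
  rewrite /= cats0 AP (_ : n = 0); last by lia.
  case: s => [|[a b] s] //.
  rewrite !overpart_le_cons is_overpartition_cons; lia.
rewrite /= mem_cat AP.
case: s => [|[a b] s].
  rewrite /overpart_le !andbT; case: (is_overpartition n [::]) => //=.
  by case: ifP => // _; apply/negP => /mapP[].
have memP : ((a, b) :: s \in (if m < n then
   [seq (m.+1, false) :: s0 | s0 <- overparts_tail m.+1 A k (n - m.+1)] else [::]))
  = [&& a == m.+1, ~~ b & is_overpartition n ((a, b) :: s)].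
  rewrite is_overpartition_cons; case: (ltnP m n) => [ltmn|lenm]; last first.
    rewrite in_nil; case: eqP => //= ->; lia.
  apply/mapP/and3P => [[t tin [-> -> ->]]|[/eqP-> nb]].
    by split=> //; rewrite ltmn -IHk //; lia.
  move=> /and3P[_ _ st]; exists s; last by case: b nb.
  by rewrite IHk //; lia.
rewrite memP !overpart_le_cons inE negb_or xpair_eqE /=.
case os: (is_overpartition n ((a, b) :: s)); rewrite ?andbF ?andbT //.
move: os; rewrite is_overpartition_cons => /and4P[_ _ /andP[_ als] nas].
have notin : a <= m.+1 -> (m.+1, true) \notin s.
  rewrite leq_eqVlt => /orP[/eqP<- //|ltam].
  by apply/negP => /(allP als) /=; lia.
by case: (leqP a m.+1) notin => [lea /(_ isT)->|lta _]; case: b {memP} => /=; lia.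
Qed.

Lemma overpartsP m n s : (s \in overparts m n) = overpart_le m n s.
Proof.
elim: m n s => [|m IHm] n s /=.
  case: s => [|[a b] s].
    by rewrite /overpart_le is_overpartition_nil andbT; case: eqP.
  by rewrite overpart_le_cons is_overpartition_cons; case: a; case: (n == 0).
rewrite mem_cat IHm; case: s => [|[a b] s].
  rewrite /overpart_le !andbT; case: is_overpartition => //=.
  by case: ifP => // _; rewrite mem_cat; apply/negP => /orP[] /mapP[].
rewrite !overpart_le_cons [a <= m.+1]leq_eqVlt andb_orl orbC; congr (_ || _).
rewrite is_overpartition_cons; case: (ltnP m n) => [ltmn|lenm]; last first.
  rewrite in_nil; case: eqP => //= ->; lia.
rewrite mem_cat; apply/orP/andP => [|[/eqP->]].
  by case=> /mapP[t]; rewrite (overparts_tailP IHm) ?leq_subr //;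
    move=> /andP[ot nt] [-> _ ->]; rewrite ot nt eqxx ltmn.
move=> /and4P[_ _ st ns]; case: b; [left|right]; apply: map_f;
  by rewrite (overparts_tailP IHm) ?leq_subr // st ns.
Qed.

Lemma overparts_tail_uniq m A k n :
  (forall n s, (s \in A n) = overpart_le m n s) -> (forall n, uniq (A n)) ->
  uniq (overparts_tail m.+1 A k n).
Proof.
move=> AP uA; elim: k n => [|k IHk] n; first by rewrite /= cats0.
rewrite /= cat_uniq uA /=; case: ifP => // _.
rewrite (map_inj_uniq (fun s t => _)) ?IHk ?andbT //; last by move=> ? ? [].
apply/hasPn => _ /mapP[s _ ->]; rewrite AP overpart_le_cons; lia.
Qed.

Lemma overparts_uniq m n : uniq (overparts m n).
Proof.
elim: m n => [|m IHm] n /=; first by case: ifP.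
rewrite cat_uniq IHm; case: ifP => //= _.
rewrite cat_uniq.
have tail_uniq := overparts_tail_uniq n (n - m.+1) (overpartsP m) IHm.
rewrite !map_inj_uniq ?tail_uniq //=; try by move=> ? ? [].
rewrite andbT; apply/andP; split.
  apply/hasPn => s; rewrite overpartsP mem_cat => /orP[] /mapP[t _ ->];
  by rewrite overpart_le_cons ltnn.
by apply/hasPn => _ /mapP[t _ ->]; apply/negP => /mapP[].
Qed.

Lemma sum_eqn_ord (n k : nat) : k < n -> \sum_(i < n) (k == i) = 1.
Proof.
move=> ltkn; rewrite (bigD1 (Ordinal ltkn)) //= eqxx big1 ?addn0 // => i.
by rewrite -val_eqE /= eq_sym => /negbTE->.
Qed.

(** Both sides list the same overpartitions without repetition; the list is sliced by the number of
    parts. *)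
Lemma overp_size n : overp n = size (overparts n n).
Proof.
have mem_is s : (s \in overparts n n) = is_overpartition n s.
  rewrite overpartsP /overpart_le andb_idr // => /overpartition_bounded/andP[_].
  by apply: sub_all => x.
transitivity (\sum_(k < n.+1) count (fun s => size s == k) (overparts n n)).
  rewrite /overp; apply: eq_bigr => k _.
  pose lift (t : k.-tuple ('I_n.+1 * bool)) := [seq (val x.1, x.2) | x <- t].
  have lift_inj : injective lift.
    move=> t u; rewrite /lift => tu; apply/val_inj; apply: inj_map tu.
    by move=> [a b] [c d] /= [/val_inj-> ->].
  rewrite cardE -(size_map lift) -size_filter; apply: perm_size.
  apply: uniq_perm; first by rewrite map_inj_uniq ?enum_uniq.
    by rewrite filter_uniq ?overparts_uniq.
  move=> s; rewrite mem_filter mem_is; apply/mapP/andP => [[t]|[/eqP sk os]].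
    by rewrite mem_enum inE => ot ->; rewrite size_map size_tuple eqxx.
  have /andP[_ /allP s_le] := overpartition_bounded os.
  have tk : size [seq (inord x.1 : 'I_n.+1, x.2) | x <- s] == k.
    by rewrite size_map sk.
  have sE : s = lift (Tuple tk).
    rewrite /lift /= -map_comp; apply/esym/map_id_in => -[a b] /s_le /= ltan.
    by rewrite inordK.
  by exists (Tuple tk) => //; rewrite mem_enum inE -/(lift _) -sE.
have : all (fun s => size s < n.+1) (overparts n n).
  by apply/allP => s; rewrite mem_is => /overpartition_bounded/andP[].
elim: (overparts n n) => [|s l IHl] /=; first by rewrite big1.
by move=> /andP[ls /IHl ll]; rewrite big_split /= ll sum_eqn_ord.
Qed.

Lemma overparts_tail_fuel m A k n :
  n <= k -> overparts_tail m.+1 A k n = overparts_tail m.+1 A n n.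
Proof.
have stepk l i : i <= l -> overparts_tail m.+1 A l.+1 i = overparts_tail m.+1 A l i.
  elim: l i => [|l IHl] i lei; first by rewrite /= ifF //; lia.
  rewrite overparts_tailS [in RHS]overparts_tailS.
  by case: ifP => // lti; rewrite IHl //; lia.
move/subnK <-; elim: (k - n) => // d IHd.
by rewrite addSn stepk ?leq_addl.
Qed.

(** Coefficient form of (1 - q^(m+1)) G_(m+1) = (1 + q^(m+1)) G_m, where G_m counts overpartitions
    with parts at most m. *)
Lemma size_overpartsS m n :
  size (overparts m.+1 n) =
  if m < n then
    size (overparts m n) + size (overparts m (n - m.+1)) +
      size (overparts m.+1 (n - m.+1))
  else size (overparts m n).
Proof.
(* [b] counts the tails, so it has generating function G_m / (1 - q^(m+1)); eliminating it from [bE]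
   and [aE] gives the recurrence. *)
pose b i := size (overparts_tail m.+1 (overparts m) i i).
have bE i : b i = size (overparts m i) + if m < i then b (i - m.+1) else 0.
  rewrite /b; case: i => [|i]; first by rewrite /= size_cat.
  rewrite overparts_tailS size_cat; congr (_ + _).
  by case: ifP => // lt; rewrite size_map overparts_tail_fuel //; lia.
have aE i : size (overparts m.+1 i) =
    size (overparts m i) + if m < i then (b (i - m.+1)).*2 else 0.
  rewrite /= size_cat; case: ifP => // lt.
  by rewrite size_cat !size_map overparts_tail_fuel ?leq_subr // addnn.
rewrite !aE; case: ifP => // lt; rewrite ?addn0 //.
by rewrite (bE (n - m.+1)); case: ifP => _; lia.
Qed.

(** * The generating polynomial and its expansion modulo 16 *)

Section GeneratingPolynomial.
Local Open Scope ring_scope.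

Lemma eqmod_coefP (R : comNzRingType) n (p r : {poly R}) :
  eqmod 'X^n p r <-> (forall i, (i < n)%N -> p`_i = r`_i).
Proof.
split=> [[c ->] i ltin|coefE].
  by rewrite coefD coefMXn ltin addr0.
exists (drop_poly n (p - r)); rewrite -[LHS](subrK r) addrC; congr (_ + _).
rewrite -[LHS](poly_take_drop n) [X in X + _](_ : _ = 0) ?add0r //.
apply/polyP => i; rewrite coef_take_poly coef0; case: ifP => // ltin.
by rewrite coefB coefE // subrr.
Qed.

Definition overp_poly (m M : nat) : {poly int} :=
  \poly_(n < M) (size (overparts m n))%:Z.

Lemma overp_polyS m M :
  eqmod 'X^M ((1 - 'X^(m.+1)) * overp_poly m.+1 M) ((1 + 'X^(m.+1)) * overp_poly m M).
Proof.
apply/eqmod_coefP => i ltiM.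
rewrite mulrBl mulrDl !mul1r coefB coefD !coefXnM !coef_poly ltiM ltnS.
rewrite [in X in X - _]size_overpartsS.
by case: leqP => // lemi; rewrite ?subr0 ?addr0 // (leq_ltn_trans (leq_subr _ _) ltiM); lia.
Qed.

Lemma overp_poly_prod m M :
  eqmod 'X^M (qfact 'X m * overp_poly m M) (\prod_(i < m) (1 + 'X^(i.+1))).
Proof.
elim: m => [|m IHm].
  rewrite /qfact !big_ord0 mul1r; apply/eqmod_coefP => i ltiM.
  by rewrite coef_poly ltiM coef1 /=; case: eqP.
rewrite qfactS big_ord_recr /= -mulrA.
apply: (@eqmod_trans _ _ (qfact 'X m * ((1 + 'X^(m.+1)) * overp_poly m M))).
  by apply: eqmodM; [exact: eqmod_refl|exact: overp_polyS].
by rewrite mulrCA mulrC; apply: eqmodM => //; exact: eqmod_refl.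
Qed.

Definition theta (n : nat) : {poly int} := \sum_(1 <= j < n.+1) (-1) ^+ j * 'X^(j ^ 2).

Lemma overp_poly_theta n :
  eqmod 'X^(n.+1) (overp_poly n n.+1 * (1 + 2 * theta n)) 1.
Proof.
apply: (@eqmod_cancel _ _ _ (qfact 'X n)); first exact: qfact_eqmod1.
rewrite mulr1; apply: eqmod_trans (gauss_eqmod _ _).
rewrite mulrA mulrC; apply: eqmodM; first exact: eqmod_refl.
exact: overp_poly_prod.
Qed.

Lemma overp_theta_mod16 n : (0 < n)%N ->
  (16 %| (overp n)%:Z + 2 * (theta n)`_n - 4 * (theta n ^+ 2)`_n
         + 8 * (theta n ^+ 3)`_n)%Z.
Proof.
move=> n_gt0; set t := theta n.
have [c Ot] := overp_poly_theta n; rewrite -/t in Ot.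
have /eqmod_coefP/(_ n (ltnSn n)) : eqmod 'X^(n.+1)
    (overp_poly n n.+1 + 2 * t - 4 * t ^+ 2 + 8 * t ^+ 3)
    (1 + 16 * (overp_poly n n.+1 * t ^+ 4)).
  (* The multiplier is the truncated geometric series for 1 / (1 + 2t): its product with 1 + 2t is 1
     - 16 t^4. *)
  exists (c * (1 - 2 * t + 4 * t ^+ 2 - 8 * t ^+ 3)).
  transitivity (1 + 16 * (overp_poly n n.+1 * t ^+ 4) +
    c * (1 - 2 * t + 4 * t ^+ 2 - 8 * t ^+ 3) * 'X^(n.+1) +
    (overp_poly n n.+1 * (1 + 2 * t) - (1 + c * 'X^(n.+1)))
      * (1 - 2 * t + 4 * t ^+ 2 - 8 * t ^+ 3)); first by ring.
  by rewrite Ot subrr mul0r addr0.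
rewrite !mulr_natl !coefD coefN !coefMn coef1 coef_poly ltnSn -overp_size.
rewrite gtn_eqF // add0r => ->.
by apply/dvdzP; exists (overp_poly n n.+1 * t ^+ 4)`_n; rewrite [RHS]mulr_natr.
Qed.

End GeneratingPolynomial.

(** * Representations by sums of squares and by x^2 + 2 y^2 *)

Lemma mod3P x : exists y, [\/ x = 3 * y, x = 3 * y + 1 | x = 3 * y + 2].
Proof.
exists (x %/ 3); have : x %% 3 < 3 by rewrite ltn_mod.
by case E: (x %% 3) => [|[|[|r]]] // _;
  [constructor 1|constructor 2|constructor 3]; lia.
Qed.

Lemma sum_squares_dvd3 x y : 3 %| x ^ 2 + y ^ 2 -> (3 %| x) && (3 %| y).
Proof.
have [a xE] := mod3P x; have [b yE] := mod3P y.
by case: xE => ->; case: yE => ->; nia.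
Qed.

(** Descent: 3 divides both [x] and [y], so dividing by 9 lowers the exponent by 2, until 9 would
    have to divide 3m. *)
Lemma sum_squares_neq a m x y :
  ~~ (3 %| m) -> x ^ 2 + y ^ 2 != 3 ^ (2 * a + 1) * m.
Proof.
move=> m3; elim: a x y => [|a IHa] x y; apply/eqP => E.
  have /andP[x3 y3] : (3 %| x) && (3 %| y).
    by apply: sum_squares_dvd3; rewrite E dvdn_mulr.
  case/dvdnP: x3 E => u ->; case/dvdnP: y3 => v ->; nia.
have /andP[x3 y3] : (3 %| x) && (3 %| y).
  by apply: sum_squares_dvd3; rewrite E addn1 expnS -mulnA dvdn_mulr.
case/dvdnP: x3 E => u ->; case/dvdnP: y3 => v -> E.
have /eqP[] := IHa u v; move: E.
rewrite (_ : 2 * a.+1 + 1 = 2 + (2 * a + 1)) ?expnD; last by lia.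
nia.
Qed.

(** * Solutions of x^2 + 2 y^2 = n and their behaviour at 3 *)

Lemma norm_dvd3 x y : 3 %| x ^ 2 + 2 * y ^ 2 -> (3 %| x) = (3 %| y).
Proof.
have [a xE] := mod3P x; have [b yE] := mod3P y.
by case: xE => ->; case: yE => ->; nia.
Qed.

Definition norm_reps (n : nat) : seq (nat * nat) :=
  [seq p <- allpairs pair (iota 1 n) (iota 1 n) | p.1 ^ 2 + 2 * p.2 ^ 2 == n].

(** When 3 divides [n], testing one coordinate is enough: by [norm_dvd3], 3 divides both or
    neither. *)
Definition primitive_reps (n : nat) := [seq p <- norm_reps n | ~~ (3 %| p.1)].

Lemma norm_reps_uniq n : uniq (norm_reps n).
Proof. by rewrite filter_uniq // allpairs_uniq ?iota_uniq // => -[? ?] [? ?]. Qed.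

Lemma norm_repsP n x y :
  ((x, y) \in norm_reps n) = [&& 0 < x, 0 < y & x ^ 2 + 2 * y ^ 2 == n].
Proof.
rewrite mem_filter /= andbC; apply/andP/and3P => [[/allpairsP[[u v]]]|[x0 y0 E]].
  by rewrite !mem_iota => /= -[/andP[u0 _] /andP[v0 _] [-> ->]] ->.
by split=> //; apply: (allpairs_f pair); rewrite mem_iota; nia.
Qed.

Lemma primitive_repsP n x y :
  ((x, y) \in primitive_reps n) =
  [&& ~~ (3 %| x), 0 < x, 0 < y & x ^ 2 + 2 * y ^ 2 == n].
Proof. by rewrite mem_filter norm_repsP. Qed.

Lemma size_bij (T : eqType) (s t : seq T) (f g : T -> T) :
  uniq s -> uniq t ->
  {in s, forall x, f x \in t} -> {in t, forall x, g x \in s} ->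
  {in s, cancel f g} -> {in t, cancel g f} -> size s = size t.
Proof.
move=> us ut fst gts fK gK; apply/eqP; rewrite eqn_leq; apply/andP; split.
  rewrite -(size_map f); apply: uniq_leq_size.
    by rewrite map_inj_in_uniq //; apply: can_in_inj fK.
  by move=> _ /mapP[x xs ->]; apply: fst.
rewrite -(size_map g); apply: uniq_leq_size.
  by rewrite map_inj_in_uniq //; apply: can_in_inj gK.
by move=> _ /mapP[x xs ->]; apply: gts.
Qed.

(* Multiplication of [x + y sqrt (-2)] by the one of [1 + sqrt (-2)] and
   [1 - sqrt (-2)] that keeps it primitive at 3, up to signs.  The sum of the two
   truncated differences is an absolute value. *)
Definition norm_mul (p : nat * nat) :=
  let: (x, y) := p in
  if x == y %[mod 3] then ((x - 2 * y) + (2 * y - x), x + y)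
  else (x + 2 * y, (x - y) + (y - x)).

(** Division by an element of norm 3: multiply by its conjugate, then divide by 3. The branch is the
    one where both quotients are exact on primitive solutions. *)
Definition norm_div (p : nat * nat) :=
  let: (x, y) := p in
  if x == y %[mod 3] then ((x + 2 * y) %/ 3, ((x - y) + (y - x)) %/ 3)
  else (((x - 2 * y) + (2 * y - x)) %/ 3, (x + y) %/ 3).

Lemma norm_mulK x y : ~~ (3 %| x) -> ~~ (3 %| y) -> norm_div (norm_mul (x, y)) = (x, y).
Proof.
move=> x3 y3; rewrite /norm_mul; case: eqP => xy; rewrite /norm_div;
  case: eqP => uv; congr (_, _); lia.
Qed.

Lemma norm_mul_primitive n : 3 %| n ->
  {in primitive_reps n, forall p, norm_mul p \in primitive_reps (3 * n)}.
Proof.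
move=> n3 [x y]; rewrite primitive_repsP => /and4P[x3 x0 y0 /eqP E].
have y3 : ~~ (3 %| y) by rewrite -(@norm_dvd3 x y) // E.
rewrite /norm_mul; case: eqP => xy; rewrite primitive_repsP; apply/and4P; split; lia.
Qed.

(** In each case the second quotient is named [t] and the equation is divided by 3. Since 9 divides
    3n, what remains is a congruence modulo 3 that yields primitivity and selects the branch of
    [norm_mul] that undoes the division. *)
Lemma norm_divP n p : 3 %| n -> p \in primitive_reps (3 * n) ->
  norm_div p \in primitive_reps n /\ norm_mul (norm_div p) = p.
Proof.
case: p => u v n3; rewrite primitive_repsP => /and4P[u3 u0 v0 /eqP E].
have v3 : ~~ (3 %| v) by rewrite -(@norm_dvd3 u v) // E dvdn_mulr.
case/dvdnP: n3 E => k -> E.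
have [uv|uv] := eqVneq (u %% 3) (v %% 3).
  have [le|lt] := leqP v u.
    have [t tE] : exists t, u = v + 3 * t by exists ((u - v) %/ 3); lia.
    have vt : t %% 3 = v %% 3.
      have {}E : v ^ 2 + 2 * t * v + 3 * t ^ 2 = 3 * k by rewrite tE in E; nia.
      have [a aE] := mod3P v; have [b bE] := mod3P t.
      by case: aE bE v3 E => -> [] ->; nia.
    have -> : norm_div (u, v) = (v + t, t).
      by rewrite /norm_div uv eqxx; congr (_, _); lia.
    rewrite /norm_mul ifN; last by apply/eqP; lia.
    split; last by congr (_, _); lia.
    rewrite primitive_repsP; apply/and4P; split; lia.
  have [t tE] : exists t, v = u + 3 * t by exists ((v - u) %/ 3); lia.
  have ut : (u + t) %% 3 = 0.
    have {}E : u ^ 2 + 4 * t * u + 6 * t ^ 2 = 3 * k by rewrite tE in E; nia.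
    have [a aE] := mod3P u; have [b bE] := mod3P t.
    by case: aE bE u3 E => -> [] ->; nia.
  have -> : norm_div (u, v) = (u + 2 * t, t).
    by rewrite /norm_div uv eqxx; congr (_, _); lia.
  rewrite /norm_mul ifT; last by apply/eqP; lia.
  split; last by congr (_, _); lia.
  rewrite primitive_repsP; apply/and4P; split; lia.
have [t tE] : exists t, u + v = 3 * t by exists ((u + v) %/ 3); lia.
have {}E : v ^ 2 + 3 * t ^ 2 = 3 * k + 2 * t * v.
  have sq : (u + v) ^ 2 = (3 * t) ^ 2 by rewrite tE.
  have tv : (u + v) * v = 3 * t * v by rewrite tE.
  lia.
have vt : t %% 3 != v %% 3 /\ t %% 3 != 0.
  have [a aE] := mod3P v; have [b bE] := mod3P t.
  by case: aE bE v3 E => -> [] ->; nia.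
have -> : norm_div (u, v) = ((t - v) + (v - t), t).
  by rewrite /norm_div (negbTE uv); congr (_, _); lia.
split.
  rewrite primitive_repsP; apply/and4P; split; lia.
by rewrite /norm_mul; clear E; case: eqP => ?; congr (_, _); lia.
Qed.

Lemma size_primitive_reps3 n : 3 %| n ->
  size (primitive_reps (3 * n)) = size (primitive_reps n).
Proof.
move=> n3; apply/esym.
apply: (@size_bij _ _ _ norm_mul norm_div);
  try exact: filter_uniq (norm_reps_uniq _).
- exact: (norm_mul_primitive n3).
- by move=> p /(norm_divP n3)[].
- move=> [x y]; rewrite primitive_repsP => /and4P[x3 _ _ /eqP E].
  by apply: norm_mulK => //; rewrite -(@norm_dvd3 x y) ?E.
- by move=> p /(norm_divP n3)[].
Qed.

(** The non-primitive solutions are three times the solutions for [n]. *)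
Lemma size_norm_reps9 n :
  size (norm_reps (9 * n)) = size (primitive_reps (9 * n)) + size (norm_reps n).
Proof.
rewrite -(count_predC (fun p => ~~ (3 %| p.1))) -!size_filter; congr (_ + _).
rewrite -(size_map (fun p => (3 * p.1, 3 * p.2)) (norm_reps n)).
apply: perm_size; apply: uniq_perm; first exact: filter_uniq (norm_reps_uniq _).
  by rewrite map_inj_uniq ?norm_reps_uniq // => -[a b] [c d] [] *; congr (_, _); lia.
move=> [x y]; rewrite mem_filter /= negbK norm_repsP.
apply/andP/mapP => [[x3 /and3P[x0 y0 /eqP E]]|[[u v]]].
  have y3 : 3 %| y by rewrite -(@norm_dvd3 x y) // E; lia.
  case/dvdnP: x3 x0 E => u ->; case/dvdnP: y3 y0 => v -> v0 u0 E.
  exists (u, v); last by rewrite /= ![3 * _]mulnC.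
  by rewrite norm_repsP; apply/and3P; split; lia.
rewrite norm_repsP => /and3P[u0 v0 /eqP <-] [-> ->].
split; first by lia.
by apply/and3P; split; try lia; apply/eqP; nia.
Qed.

(** Passing from n to 81n adds two sets of primitive solutions of equal size, so parity is kept. At
    27m the count is that of the primitive solutions for 27m plus that of all solutions for 3m; the
    latter are all primitive since 9 does not divide 3m, so the two counts agree. *)
Lemma norm_reps_even a m : 0 < a -> ~~ (3 %| m) ->
  ~~ odd (size (norm_reps (3 ^ (4 * a - 1) * m))).
Proof.
move=> a_gt0 m3; have step n : 3 %| n ->
    odd (size (norm_reps (81 * n))) = odd (size (norm_reps n)).
  move=> n3; rewrite (_ : 81 * n = 9 * (9 * n)); last by lia.
  have -> : size (norm_reps (9 * (9 * n))) =
      (size (primitive_reps n)).*2 + size (norm_reps n).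
    rewrite !size_norm_reps9 addnA -addnn.
    rewrite (_ : 9 * (9 * n) = 3 * (3 * (3 * (3 * n)))); last by lia.
    rewrite (_ : 9 * n = 3 * (3 * n)); last by lia.
    by rewrite !size_primitive_reps3 // dvdn_mulr.
  by rewrite oddD odd_double.
case: a a_gt0 => // a _; rewrite (_ : 4 * a.+1 - 1 = 4 * a + 3); last by lia.
elim: a => [|a IHa].
  rewrite (_ : 3 ^ (4 * 0 + 3) * m = 9 * (3 * m)); last by lia.
  rewrite size_norm_reps9.
  have <- : primitive_reps (3 * m) = norm_reps (3 * m).
    apply/all_filterP/allP => -[x y]; rewrite norm_repsP => /and3P[_ _ /eqP E].
    apply/negP => /= x3.
    have y3 : 3 %| y by rewrite -(@norm_dvd3 x y) // E dvdn_mulr.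
    move/negP: m3; apply; move: E; case/dvdnP: x3 => u ->; case/dvdnP: y3 => v ->.
    by move=> E; apply/dvdnP; exists (u ^ 2 + 2 * v ^ 2); nia.
  rewrite (_ : 9 * (3 * m) = 3 * (3 * (3 * m))); last by lia.
  rewrite (@size_primitive_reps3 (3 * (3 * m))) ?dvdn_mulr //.
  by rewrite (@size_primitive_reps3 (3 * m)) ?dvdn_mulr // addnn odd_double.
rewrite (_ : 4 * a.+1 + 3 = 4 + (4 * a + 3)); last by lia.
rewrite expnD -mulnA step // dvdn_mulr //.
by rewrite addnC expnD dvdn_mulr.
Qed.

(** * The coefficients modulo 16 *)

Section Coefficients.
Local Open Scope ring_scope.

Lemma coef_signXn (R : nzRingType) j e n :
  ((-1) ^+ j * 'X^e : {poly R})`_n = (-1) ^+ j * (n == e)%:R.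
Proof.
rewrite -signr_odd -[in RHS]signr_odd; case: (odd j).
  by rewrite !mulN1r coefN coefXn.
by rewrite !mul1r coefXn.
Qed.

(** A square is a sum of two squares with [y = 0]. *)
Lemma theta_coef0 n : (forall x y, x ^ 2 + y ^ 2 != n)%N -> (theta n)`_n = 0.
Proof.
move=> nosq; rewrite /theta coef_sum big1 // => j _.
rewrite coef_signXn eq_sym -[(j ^ 2)%N]addn0.
by rewrite (negbTE (nosq j 0)) mulr0.
Qed.

Lemma theta_sqr_coef0 n :
  (forall x y, x ^ 2 + y ^ 2 != n)%N -> (theta n ^+ 2)`_n = 0.
Proof.
move=> nosq; rewrite expr2 /theta mulr_suml coef_sum big1 // => j _.
rewrite mulr_sumr coef_sum big1 // => l _.
by rewrite mulrACA -!exprD coef_signXn eq_sym (negbTE (nosq j l)) mulr0.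
Qed.

Lemma sqr_sum_mod2 (R : comNzRingType) m n (f : nat -> R) :
  eqmod 2 ((\sum_(m <= i < n) f i) ^+ 2) (\sum_(m <= i < n) f i ^+ 2).
Proof.
elim/big_ind2: _ => [|x2 x1 y2 y1 [c E1] [d E2]|i _]; last exact: eqmod_refl.
  by rewrite expr0n; exact: eqmod_refl.
exists (c + d + x1 * y1); transitivity (x1 ^+ 2 + y1 ^+ 2 + 2 * x1 * y1).
  by ring.
by rewrite E1 E2; ring.
Qed.

Lemma size_norm_reps n :
  size (norm_reps n) =
  (\sum_(1 <= x < n.+1) \sum_(1 <= y < n.+1) (x ^ 2 + 2 * y ^ 2 == n))%N.
Proof.
rewrite /norm_reps size_filter -sum1_count big_mkcond big_allpairs /=.
rewrite /index_iota subn1 /=; apply: eq_bigr => x _; apply: eq_bigr => y _.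
by case: eqP.
Qed.

(** Squaring is additive modulo 2, which replaces one square of theta by theta(q^2) without signs;
    the remaining signs do not affect parity. *)
Lemma theta_cube_mod2 n :
  eqmod 2 (theta n ^+ 3)`_n (size (norm_reps n))%:Z.
Proof.
have [b tE] : eqmod 2 (theta n ^+ 2) (\sum_(1 <= y < n.+1) 'X^(2 * y ^ 2)).
  rewrite [X in eqmod _ _ X](eq_bigr (fun y => ((-1) ^+ y * 'X^(y ^ 2)) ^+ 2)).
    exact: sqr_sum_mod2.
  by move=> y _; rewrite exprMn sqrr_sign mul1r -exprM mulnC.
apply: (@eqmod_trans _ _ (theta n * \sum_(1 <= y < n.+1) 'X^(2 * y ^ 2))`_n).
  exists (theta n * b)`_n; rewrite exprS tE mulrDr coefD; congr (_ + _).
  by rewrite mulrA !mulr_natr coefMn.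
rewrite size_norm_reps /theta mulr_suml coef_sum -!natz natr_sum.
apply: eqmod_sum => x _; rewrite mulr_sumr coef_sum natr_sum.
apply: eqmod_sum => y _; rewrite -mulrA -exprD coef_signXn eq_sym.
rewrite -[X in eqmod _ _ X]mul1r; apply: eqmodM; last exact: eqmod_refl.
rewrite -signr_odd; case: (odd x); last exact: eqmod_refl.
by exists (-1).
Qed.

End Coefficients.

(** * The congruences *)

Lemma overp_mod8 a m : ~~ (3 %| m) -> overp (3 ^ (2 * a + 1) * m) = 0 %[mod 8].
Proof.
move=> m3; have nosq := sum_squares_neq a _ _ m3.
have n0 : 0 < 3 ^ (2 * a + 1) * m.
  by rewrite muln_gt0 expn_gt0; case: m m3 {nosq}.
have := overp_theta_mod16 n0; rewrite theta_coef0 // theta_sqr_coef0 //; lia.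
Qed.

Lemma overp_mod16 a m : 0 < a -> ~~ (3 %| m) ->
  overp (3 ^ (4 * a - 1) * m) = 0 %[mod 16].
Proof.
move=> a0 m3.
have nosq : forall x y, x ^ 2 + y ^ 2 != 3 ^ (4 * a - 1) * m.
  move=> x y; rewrite (_ : 4 * a - 1 = 2 * (2 * a - 1) + 1); last by lia.
  exact: sum_squares_neq.
have n0 : 0 < 3 ^ (4 * a - 1) * m.
  by rewrite muln_gt0 expn_gt0; case: m m3 {nosq}.
have [b cubeE] := theta_cube_mod2 (3 ^ (4 * a - 1) * m).
have := norm_reps_even a0 m3.
have := overp_theta_mod16 n0; rewrite theta_coef0 // theta_sqr_coef0 // cubeE; lia.
Qed.

Theorem theorem4p3 (alpha n i : nat) (halpha : 1 <= alpha)
    (hi : i = 1 \/ i = 2) :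
  [/\ overp (4 * 3 ^ (2 * alpha) * n + (4 * i + 3) * 3 ^ (2 * alpha - 1))
        = 0 %[mod 2 ^ 2],
      overp (4 * 3 ^ (2 * alpha) * n + (4 * i + 6) * 3 ^ (2 * alpha - 1))
        = 0 %[mod 2 ^ 3]
    & overp (4 * 3 ^ (4 * alpha) * n + (4 * i + 9) * 3 ^ (4 * alpha - 1))
        = 0 %[mod 2 ^ 4]].
Proof.
(* Factoring out 3^(k-1) leaves 12n + c, which is prime to 3 for c = 4i+3, 4i+6, 4i+9 because i is 1
   or 2. *)
have splitE k c : 0 < k ->
    4 * 3 ^ k * n + c * 3 ^ (k - 1) = 3 ^ (k - 1) * (12 * n + c).
  by case: k => // k _; rewrite subn1 /= expnS; lia.
have oddE : 2 * alpha - 1 = 2 * (alpha - 1) + 1 by lia.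
rewrite !splitE; try lia; split.
(* The congruence modulo 4 is read off from the one modulo 8. *)
- have m3 : ~~ (3 %| 12 * n + (4 * i + 3)) by case: hi => ->; lia.
  by have := overp_mod8 (alpha - 1) m3; rewrite -oddE; lia.
- rewrite oddE; apply: overp_mod8; case: hi => ->; lia.
- apply: overp_mod16 => //; case: hi => ->; lia.
Qed.
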